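(* Let $\mathbb V$ be a linear space equipped with an $n$-linear map $f:\mathbb V\times\cdots\times\mathbb V\to\mathbb V$ and let $\mathcal B=\{e_i:i\in I\}$ be a fixed basis of $\mathbb V$. Let $g:\mathbb V\to\mathbb V$ be a linear isomorphism satisfying $f(g(\xi_1),\dots,g(\xi_n))=g(f(\xi_1,\dots,\xi_n))$ for any $\xi_1,\dots,\xi_n\in\mathcal B$. Then the decompositions $$\Gamma:\ \mathbb V=\bigoplus_{[V_{[e_i]}]\in\mathcal F/\approx}\overbrace{V_{[e_i]}}\qquad\text{and}\qquad\Gamma':\ \mathbb V=\bigoplus_{[V_{[g(e_i)]}]\in\mathcal F'/\approx}\overbrace{V_{[g(e_i)]}},$$ obtained by the construction described in the context from the bases $\mathcal B$ and $\mathcal B':=\{g(e_i):i\in I\}$ respectively, are isomorphic.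
   Context: Linear spaces are over an arbitrary field $\mathbb F$ and of arbitrary dimension; $n\ge 2$; $f:\mathbb V\times\cdots\times\mathbb V\to\mathbb V$ ($n$ factors) is $n$-linear. A superscript $(k)$ marks the $k$-th entry of $f$: $f(\mathbb V,\dots,W^{(k)},\dots,\mathbb V)$ is the span of all values of $f$ with $k$-th entry in $W$ and all other entries in $\mathbb V$, and $f(\mathbb V,\dots,V_1^{(k_1)},\dots,V_2^{(k_2)},\dots,\mathbb V)$ is the span of all values with $k_1$-th entry in $V_1$, $k_2$-th entry in $V_2$ and the other entries in $\mathbb V$. Subspaces $V_1,V_2$ are $f$-orthogonal if $f(\mathbb V,\dots,V_1^{(i)},\dots,V_2^{(j)},\dots,\mathbb V)=0$ for all $i\ne j$ in $\{1,\dots,n\}$; a direct sum decomposition is $f$-orthogonal if its distinct summands are pairwise $f$-orthogonal. A subspace $W$ is strongly $f$-invariant if $f(\mathbb V,\dots,W^{(i)},\dots,\mathbb V)\subset W$ for all $i\in\{1,\dots,n\}$. Two decompositions $\mathbb V=\bigoplus_{i\in I}V_i$ and $\mathbb V=\bigoplus_{j\in J}W_j$ as $f$-orthogonal direct sums of strongly $f$-invariant subspaces are isomorphic if there exist a linear isomorphism $g:\mathbb V\to\mathbb V$ with $f(g(v_1),\dots,g(v_n))=g(f(v_1,\dots,v_n))$ for all $v_1,\dots,v_n\in\mathbb V$ and a bijection $\sigma:I\to J$ with $g(V_i)=W_{\sigma(i)}$ for all $i\in I$. Construction from a basis $\mathcal B$ (it always yields an $f$-orthogonal direct sum of strongly $f$-invariant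 subspaces; for $\mathcal B'$ apply it with $\mathcal B'$ in place of $\mathcal B$, the resulting family being denoted $\mathcal F'$). For each $e\in\mathcal B$ introduce a symbol $\overline e\notin\mathcal B$; $\overline{\mathcal B}=\{\overline e:e\in\mathcal B\}$, $\overline{(\overline e)}:=e$. Let $\mathbb V^*=\mathbb V\setminus\{0\}$ and $\mathcal P(\mathbb V^* )$ its power set. Define $F:\mathcal P(\mathbb V^* )\times(\mathcal B\dot\cup\overline{\mathcal B})^{n-1}\to\mathcal P(\mathbb V^* )$ as follows: $F(\emptyset,\dots)=\emptyset$; for $U\ne\emptyset$ and $\xi_1,\dots,\xi_{n-1}\in\mathcal B$, $$F(U,\xi_1,\dots,\xi_{n-1})=\Big(\bigcup_{1\le k\le n,\ \sigma\in\mathbb S_{n-1}}\{f(\xi_{\sigma(1)},\dots,u^{(k)},\dots,\xi_{\sigma(n-1)}):u\in U\}\Big)\setminus\{0\},$$ $$F(U,\overline\xi_1,\dots,\overline\xi_{n-1})=\Big(\bigcup_{1\le k\le n,\ \sigma\in\mathbb S_{n-1}}\{u\in\mathbb V:f(\xi_{\sigma(1)},\dots,u^{(k)},\dots,\xi_{\sigma(n-1)})\in U\}\Big)\setminus\{0\},$$ where $u$ is in the $k$-th entry and the remaining entries are filled in order by $\xi_{\sigma(1)},\dots,\xi_{\sigma(n-1)}$; and $F(U,\dots)=\emptyset$ if among the last $n-1$ arguments there is one in $\mathcal B$ and one in $\overline{\mathcal B}$. $e_i\in\mathcal B$ is connected to $e_j\in\mathcal B$ (written $e_i\sim e_j$)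 if $e_i=e_j$ or there is an ordered list $(X_1,\dots,X_m)$, $m\ge1$, of $(n-1)$-tuples $X_r\in(\mathcal B\dot\cup\overline{\mathcal B})^{n-1}$ such that $F(\{e_i\},X_1)\ne\emptyset$, $F(F(\{e_i\},X_1),X_2)\neq\emptyset$, ..., $F(\dots F(F(\{e_i\},X_1),X_2)\dots,X_{m-1})\ne\emptyset$ and $e_j\in F(F(\dots F(F(\{e_i\},X_1),X_2)\dots,X_{m-1}),X_m)$. This is an equivalence relation on $\mathcal B$; $[e_i]$ is the class of $e_i$, $V_{[e_i]}:=\bigoplus_{e_j\in[e_i]}\mathbb F e_j$, so $\mathbb V=\bigoplus_{[e_i]\in\mathcal B/\sim}V_{[e_i]}$, and $\Pi_{V_{[e_i]}}:\mathbb V\to V_{[e_i]}$ is the associated projection. Let $\mathcal F=\{V_{[e_i]}:[e_i]\in\mathcal B/\sim\}$. Put $V_{[e_i]}\approx V_{[e_j]}$ iff $V_{[e_i]}=V_{[e_j]}$ or there is $\{[\xi_1],\dots,[\xi_m]\}\subset\mathcal B/\sim$ with $[\xi_1]=[e_i]$, $[\xi_m]=[e_j]$ and, for each $r=1,\dots,m-1$, $$\sum_{1\le k_1<k_2\le n}\Big[\Pi_{V_{[\xi_r]}}\big(f(\mathbb V,\dots,V_{[\xi_{r+1}]}^{(k_1)},\dots,V_{[\xi_{r+1}]}^{(k_2)},\dots,\mathbb V)\big)+\Pi_{V_{[\xi_{r+1}]}}\big(f(\mathbb V,\dots,V_{[\xi_r]}^{(k_1)},\dots,V_{[\xi_r]}^{(k_2)},\dots,\mathbb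 V)\big)\Big]\ne0$$ (a sum of linear subspaces). This is an equivalence relation on $\mathcal F$; $[V_{[e_i]}]$ denotes the class of $V_{[e_i]}$, and $\overbrace{V_{[e_i]}}:=\bigoplus_{V_{[e_j]}\in[V_{[e_i]}]}V_{[e_j]}$. The decomposition obtained from $\mathcal B$ is $\mathbb V=\bigoplus_{[V_{[e_i]}]\in\mathcal F/\approx}\overbrace{V_{[e_i]}}$. *)

(* Defs.v *)
From HB Require Import structures.
From mathcomp Require Import all_boot all_order all_fingroup all_algebra.
From mathcomp Require Import all_classical.

Set Implicit Arguments.
Unset Strict Implicit.
Unset Printing Implicit Defensive.

Import GRing.Theory.

Local Open Scope classical_set_scope.
Local Open Scope ring_scope.

(* Linear spaces have arbitrary dimension, so bases and subspaces are
   classical sets rather than terms of vectType / {vspace _}. *)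
Section LinearAlgebra.
Variables (F : fieldType) (V : lmodType F).

Definition is_subspace (W : set V) : Prop := GRing.submod_closed [in W].

Definition lspan (S : set V) : set V := smallest is_subspace S.

Definition lin_indep (B : set V) : Prop :=
  forall (s : seq V) (c : V -> F), uniq s -> (forall b, b \in s -> B b) ->
    \sum_(b <- s) c b *: b = 0 -> forall b, b \in s -> c b = 0.

Definition is_basis (B : set V) : Prop := lin_indep B /\ lspan B = setT.

(* The (not necessarily direct) sum of a set of subspaces. *)
Definition sum_subspaces (S : set (set V)) : set V := lspan (\bigcup_(W in S) W).

Section Family.
Variables (I : choiceType) (W : I -> set V).

(* v = \sum_i x i with x i in W i and almost all x i equal to 0. *)
Definition decomposes (v : V) (x : I -> V) : Prop :=
  [/\ finite_set [set i | x i != 0], (forall i, W i (x i))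
    & v = \sum_(i \in [set: I]) x i].

Definition direct_sum_decomposition : Prop :=
  (forall i, is_subspace (W i)) /\ (forall v, exists! x, decomposes v x).

(* The projection onto W i along the other summands; meaningful when W is a
   direct sum decomposition. *)
Definition proj (i : I) (v : V) : V := xget (fun=> 0) (decomposes v) i.

End Family.
End LinearAlgebra.

Definition equiv_class (T : Type) (A : set T) (R : T -> T -> Prop) (x : T) :
  set T := [set y | A y /\ R x y].

(* The quotient A / R. *)
Definition equiv_classes (T : Type) (A : set T) (R : T -> T -> Prop) :
  set (set T) := equiv_class A R @` A.

(* entry k u x = (x_0, ..., u, ..., x_(n-2)), with u at position k. *)
Definition entry (T : Type) (n : nat) (k : 'I_n) (u : T) (x : 'I_n.-1 -> T) :
  'I_n -> T := fun j => if unlift k j is Some j' then x j' else u.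

Section Multilinear.
Variables (F : fieldType) (V : lmodType F) (n : nat) (f : ('I_n -> V) -> V).

Definition multilinear : Prop :=
  forall (k : 'I_n) (x : 'I_n.-1 -> V), linear (fun u => f (entry k u x)).

Definition fval1 (k : 'I_n) (W : set V) : set V :=
  lspan (f @` [set v | W (v k)]).

Definition fval2 (k1 : 'I_n) (W1 : set V) (k2 : 'I_n) (W2 : set V) : set V :=
  lspan (f @` [set v | W1 (v k1) /\ W2 (v k2)]).

Definition f_orthogonal (W1 W2 : set V) : Prop :=
  forall i j : 'I_n, i != j -> fval2 i W1 j W2 = [set 0].

Definition strongly_f_invariant (W : set V) : Prop :=
  forall i : 'I_n, fval1 i W `<=` W.

Definition f_decomposition (I : choiceType) (W : I -> set V) : Prop :=
  [/\ direct_sum_decomposition W,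
      (forall i j, i != j -> f_orthogonal (W i) (W j))
    & forall i, strongly_f_invariant (W i)].

(* Isomorphism is a relation between f-orthogonal direct sum decompositions
   into strongly f-invariant subspaces, hence the first two clauses. *)
Definition isomorphic_decompositions (I J : choiceType)
    (W : I -> set V) (W' : J -> set V) : Prop :=
  [/\ f_decomposition W, f_decomposition W'
    & exists (g : {linear V -> V}) (sigma : I -> J),
      [/\ bijective g, (forall v : 'I_n -> V, f (g \o v) = g (f v)),
          bijective sigma & forall i, g @` W i = W' (sigma i)]].

End Multilinear.

Section Construction.
Variables (F : fieldType) (V : lmodType F) (n : nat) (f : ('I_n -> V) -> V).
Variable B : set V.

(* The disjoint union of B and its formal copy: inl e stands for e and
   inr e for \overline{e}. *)
Definition symbol : Type := (B + B)%type.

(* f(xi_(s 1), ..., u^(k), ..., xi_(s (n-1))) *)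
Definition fentry (xi : 'I_n.-1 -> B) (k : 'I_n) (s : 'S_n.-1) (u : V) : V :=
  f (entry k u (fun r => set_val (xi (s r)))).

(* When X has entries both in B and in its copy, neither clause applies and
   Fop U X is empty; so is Fop set0 X. *)
Definition Fop (U : set V) (X : 'I_n.-1 -> symbol) : set V :=
  [set w | w != 0 /\ exists xi : 'I_n.-1 -> B,
     (X = (fun r => inl (xi r)) /\ exists k s, exists2 u, U u & fentry xi k s u = w)
     \/ (X = (fun r => inr (xi r)) /\ exists k s, U (fentry xi k s w))].

Definition connected (e e' : V) : Prop :=
  e = e' \/
  exists Xs : seq ('I_n.-1 -> symbol),
    [/\ (0 < size Xs)%N,
        (forall m, (0 < m < size Xs)%N -> foldl Fop [set e] (take m Xs) !=set0)
      & foldl Fop [set e] Xs e'].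

Definition B_quot : set (set V) := equiv_classes B connected.

(* V_[e], for [e] in B / ~ *)
Definition Vclass (C : B_quot) : set V := lspan (set_val C).

Definition Vfamily : set (set V) := range Vclass.

(* The sum over k1 < k2 of images of projections, as a set of vectors. *)
Definition link_space (C D : B_quot) : set V :=
  sum_subspaces
    [set W | exists k1 k2 : 'I_n, (k1 < k2)%N /\
       (W = proj Vclass C @` fval2 f k1 (Vclass D) k2 (Vclass D) \/
        W = proj Vclass D @` fval2 f k1 (Vclass C) k2 (Vclass C))].

Definition approx (W W' : set V) : Prop :=
  W = W' \/
  exists (m : nat) (xi : nat -> B_quot),
    [/\ Vclass (xi 0%N) = W, Vclass (xi m) = W'
      & forall r, (r < m)%N -> link_space (xi r) (xi r.+1) <> [set 0]].

Definition Vfamily_quot : set (set (set V)) := equiv_classes Vfamily approx.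

(* The decomposition obtained from B, as a family indexed by Vfamily / approx. *)
Definition Gamma (c : Vfamily_quot) : set V := sum_subspaces (set_val c).

End Construction.

(* Main.v *)
Require Import Defs.
From mathcomp Require Import all_boot all_order all_fingroup all_algebra.
From mathcomp Require Import all_classical.
From Stdlib Require Import Relations.

Set Implicit Arguments.
Unset Strict Implicit.
Unset Printing Implicit Defensive.

(** The isomorphism is [g] itself.  By multilinearity [g] commutes with [f] on
    all vectors as soon as it does on the basis ([automorphism_of_basis]), so
    [g] is an automorphism of the structure (V, f), and the construction only
    uses that structure and the basis: each of its steps, performed on the
    image basis, returns the image under [g] of what it returns on [B].  This
    naturality is proved step by step: for the connection relation, for its
    classes, for the spans of the classes, for the relation between these
    spans and for its classes.  Naturality is an equivalence at each step, but
    only one implication needs an argument: the other is the same one, applied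
    to the inverse of [g].

    To make the transport visible both relations are first rewritten as
    reflexive transitive closures of relations in which neither formal copies of
    basis vectors nor projections occur ([connectedE], [approxE]).  For the
    first, one element of F(U, X) always comes from one element of U.  For
    the second, the projection of a vector on a class C vanishes exactly when
    the vector lies in the span of the basis vectors outside C.

    It must also be shown that the construction yields an f-orthogonal direct
    sum of strongly f-invariant subspaces ([Gamma_f_decomposition]).  Each
    summand is the span of a block of a partition of the basis, and spans of
    the blocks of a partitioned basis form a direct sum
    ([partition_direct_sum]).  For the two conditions on [f], multilinearity
    reduces everything to values of [f] at basis vectors
    ([multilinear_lspan]).  If such a value is nonzero, each of its arguments
    is one step away from that value, so all the arguments are connected to one
    another ([connected_value]); this is orthogonality.  If the value then
    has a nonzero component in some other class, this class is related to the
    class of the arguments, hence belongs to the same summand: this is strong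
    invariance ([Gamma_value]). *)

Import GRing.Theory.

Local Open Scope classical_set_scope.
Local Open Scope ring_scope.

(** * Subspaces and spans *)

Lemma subspaceP (F : fieldType) (V : lmodType F) (M : set V) :
  is_subspace M <->
  M 0 /\ forall (a : F) u v, M u -> M v -> M (a *: u + v).
Proof.
split=> -[M0 ML]; split.
- exact: set_mem M0.
- by move=> a u v Mu Mv; apply: set_mem; apply: ML; rewrite inE.
- exact: mem_set.
- by move=> a u v; rewrite !inE; apply: ML.
Qed.

Section Subspaces.
Variables (F : fieldType) (V : lmodType F).
Implicit Types (M S T : set V) (u v : V).

Lemma subspace0 M : is_subspace M -> M 0.
Proof. by move=> /subspaceP[]. Qed.

Lemma subspaceD M u v : is_subspace M -> M u -> M v -> M (u + v).
Proof. by move=> /subspaceP[_ ML] Mu Mv; rewrite -[u]scale1r; apply: ML. Qed.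

Lemma subspaceZ M (a : F) u : is_subspace M -> M u -> M (a *: u).
Proof.
move=> sM Mu; rewrite -[_ *: _]addr0.
by have /subspaceP[M0 ML] := sM; apply: ML.
Qed.

Lemma subspaceB M u v : is_subspace M -> M u -> M v -> M (u - v).
Proof.
by move=> sM Mu Mv; rewrite -scaleN1r; apply: subspaceD => //; apply: subspaceZ.
Qed.

Lemma subspace_sum M (I : Type) (r : seq I) (x : I -> V) :
  is_subspace M -> (forall i, M (x i)) -> M (\sum_(i <- r) x i).
Proof.
move=> sM Mx; apply: big_ind => //; first exact: subspace0.
by move=> u v; apply: subspaceD.
Qed.

Lemma subspace_set0 : is_subspace [set 0 : V].
Proof.
by apply/subspaceP; split=> // a u v /= -> ->; rewrite scaler0 addr0.
Qed.

Lemma subspace_preimage (V' : lmodType F) (h : V' -> V) M :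
  linear h -> is_subspace M -> is_subspace (h @^-1` M).
Proof.
move=> lh /subspaceP[M0 ML]; apply/subspaceP; split=> [|a u v] /=.
  have := lh (-1) 0 0; rewrite scaler0 addr0 scaleN1r addrC => h0.
  by rewrite h0 subrr.
by rewrite lh; apply: ML.
Qed.

Lemma subspace_image (V' : lmodType F) (h : V -> V') M :
  linear h -> is_subspace M -> is_subspace (h @` M).
Proof.
move=> lh /subspaceP[M0 ML]; apply/subspaceP; split.
  exists 0 => //; have := lh (-1) 0 0.
  by rewrite scaler0 addr0 scaleN1r addNr.
by move=> a _ _ [u Mu <-] [v Mv <-]; exists (a *: u + v); rewrite ?lh//; apply: ML.
Qed.

Lemma lspan_subspace S : is_subspace (lspan S).
Proof.
apply/subspaceP; split=> [M [/subspaceP[]]//|a u v Su Sv M [sM SM]].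
by have /subspaceP[_ ML] := sM; apply: ML; [apply: Su|apply: Sv].
Qed.

Lemma sub_lspan S : S `<=` lspan S. Proof. exact: sub_gen_smallest. Qed.

Lemma lspan_sub S M : is_subspace M -> S `<=` M -> lspan S `<=` M.
Proof. exact: smallest_sub. Qed.

Lemma lspan0 S : lspan S 0.
Proof. exact: subspace0 (lspan_subspace S). Qed.

Lemma lspanS S T : S `<=` T -> lspan S `<=` lspan T.
Proof.
by move=> ST; apply: lspan_sub; [exact: lspan_subspace|move=> u /ST; exact: sub_lspan].
Qed.

Lemma lspan_eq0 S : S `<=` [set 0] -> lspan S = [set 0].
Proof.
move=> S0; apply/seteqP; split; first exact: lspan_sub subspace_set0 S0.
by move=> _ ->; exact: lspan0.
Qed.

Lemma lspan_image (h : V -> V) S : linear h -> h @` lspan S = lspan (h @` S).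
Proof.
move=> lh; apply/seteqP; split=> [_ [u Su <-]|].
  suff: lspan S `<=` h @^-1` lspan (h @` S) by apply.
  apply: lspan_sub; first exact: subspace_preimage (lspan_subspace _).
  by move=> v Sv; apply: sub_lspan; exists v.
apply: lspan_sub; first exact: subspace_image (lspan_subspace _).
by apply: image_subset; apply: sub_lspan.
Qed.

(** The list may be taken without repetition, so that [lin_indep] applies to
    it: combining two combinations requires merging their supports. *)
Lemma lspan_combination S v : lspan S v -> exists (s : seq V) (c : V -> F),
  [/\ uniq s, forall b, b \in s -> S b & v = \sum_(b <- s) c b *: b].
Proof.
move: v; apply: lspan_sub; last first.
  move=> b Sb; exists [:: b], (fun=> 1); split=> // [b'|].
    by rewrite inE => /eqP->.
  by rewrite big_seq1 scale1r.
apply/subspaceP; split.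
  by exists [::], (fun=> 0); split; rewrite ?big_nil.
move=> a u v [s [c [us sS ->]]] [t [d [ut tS ->]]].
pose C b := (if b \in s then a * c b else 0) + (if b \in t then d b else 0).
exists (undup (s ++ t)), C; split; first exact: undup_uniq.
  by move=> b; rewrite mem_undup mem_cat => /orP[/sS|/tS].
(* both sums are extended by zero to the merged support *)
have widen (r : seq V) (e : V -> F) : uniq r -> {subset r <= s ++ t} ->
    \sum_(b <- r) e b *: b =
    \sum_(b <- undup (s ++ t)) (if b \in r then e b else 0) *: b.
  move=> ur rs; rewrite [RHS](bigID (mem r)) /= [X in _ + X]big1 ?addr0; last first.
    by move=> b /negPf->; rewrite scale0r.
  rewrite -[RHS]big_filter; under [RHS]eq_big_seq => b.
    rewrite mem_filter => /andP[-> _]; over.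
  apply: perm_big; apply: uniq_perm => //.
    by rewrite filter_uniq// undup_uniq.
  move=> b; rewrite mem_filter mem_undup.
  by case: (boolP (b \in r)) => //= /rs.
rewrite scaler_sumr; under eq_bigr do rewrite scalerA.
rewrite (widen s)//; last by move=> b bs; rewrite mem_cat bs.
rewrite (widen t)//; last by move=> b bt; rewrite mem_cat bt orbT.
by rewrite -big_split /=; apply: eq_bigr => b _; rewrite -scalerDl.
Qed.

Section IndependentSet.
Variables (B : set V) (indB : lin_indep B).

Lemma lin_indep_neq0 b : B b -> b != 0.
Proof.
move=> Bb; apply/eqP => b0.
have /eqP : (1 : F) = 0; last by rewrite oner_eq0.
apply: (@indB [:: b] (fun=> 1) erefl _ _ b (mem_head _ _)).
  by move=> b'; rewrite inE => /eqP->.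
by rewrite big_seq1 b0 scaler0.
Qed.

(** Equating a combination over [S] with one over [T] gives a vanishing
    combination over a list without repetition, as [S] and [T] share no
    vector. *)
Lemma lspan_disjoint S T v : S `<=` B -> T `<=` B -> S `&` T `<=` set0 ->
  lspan S v -> lspan T v -> v = 0.
Proof.
move=> SB TB ST /lspan_combination[s [c [us sS ->]]].
move=> /lspan_combination[t [d [ut tT e]]].
have stF b : b \in s -> b \in t -> False.
  by move=> /sS Sb /tT Tb; apply: (ST b).
pose C b := if b \in s then c b else - d b.
have Cs : \sum_(b <- s) C b *: b = \sum_(b <- s) c b *: b.
  by apply: eq_big_seq => b bs; rewrite /C bs.
have Ct : \sum_(b <- t) C b *: b = - \sum_(b <- t) d b *: b.
  rewrite -sumrN; apply: eq_big_seq => b bt; rewrite /C.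
  by case: ifP => [/stF/(_ bt)//|_]; rewrite scaleNr.
have C0 : forall b, b \in s ++ t -> C b = 0.
  apply: indB.
  - rewrite cat_uniq us ut andbT; apply/hasPn => b bt.
    by apply/negP => /stF/(_ bt).
  - by move=> b; rewrite mem_cat => /orP[/sS/SB|/tT/TB].
  - by rewrite big_cat /= Cs Ct -e subrr.
rewrite -Cs big1_seq// => b /= bs.
by rewrite C0 ?scale0r// mem_cat bs.
Qed.

Lemma lspan_inter S : S `<=` B -> B `&` lspan S = S.
Proof.
move=> SB; apply/seteqP; split=> [b [Bb Sb]|b Sb]; last first.
  by split; [apply: SB|apply: sub_lspan].
apply: contrapT => nSb; have /eqP := lin_indep_neq0 Bb; apply.
apply: (@lspan_disjoint S [set b]) => //; first by move=> _ ->.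
  by move=> x [Sx /= xb]; apply: nSb; rewrite -xb.
exact: sub_lspan.
Qed.

End IndependentSet.

(** * Direct sum defined by a partition of a basis *)

Section PartitionedBasis.
Variables (B : set V) (basB : is_basis B).
Variables (I : choiceType) (P : I -> set V).
Hypothesis PB : forall i, P i `<=` B.
Hypothesis Pcover : forall b, B b -> exists i, P i b.
Hypothesis Pdisj : forall i j b, P i b -> P j b -> i = j.

Let W i := lspan (P i).

(** Isolating one component reduces statements about arbitrary decompositions to
    the splitting of the basis into two disjoint parts, [P i] and its
    complement. *)
Lemma decomposes_split i v (x : I -> V) : decomposes W v x ->
  exists2 r, lspan (B `\` P i) r & v = x i + r.
Proof.
move=> [fx Wx ->].
(* [i] is added to the support so that its term can be extracted even if it
   vanishes *)
rewrite -(@fsbig_widen _ _ _ _ (i |` [set i | x i != 0])) => [||j [_ /=]]; last 2 first.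
- by [].
- by move=> /not_orP[_ /negP]; rewrite negbK => /eqP.
have fin : finite_set (i |` [set i | x i != 0]) by rewrite finite_setU.
rewrite (fsbigD1 i)//=; last by left.
eexists; last by [].
rewrite fsbig_finite; last exact: finite_setD.
rewrite big_seq.
apply: (big_ind (lspan (B `\` P i))).
- exact: lspan0.
- by move=> u w; apply: (subspaceD (lspan_subspace _)).
move=> j; rewrite in_fset_set ?inE; last exact: finite_setD.
move=> [_ /= ji]; have := Wx j; apply: lspanS => b Pb.
by split; [apply: PB Pb|move=> /(Pdisj Pb)].
Qed.

Lemma decomposes_uniq v x y : decomposes W v x -> decomposes W v y -> x = y.
Proof.
move=> dx dy; apply/funext => i; apply/eqP; rewrite -subr_eq0; apply/eqP.
have [r Br vr] := decomposes_split i dx.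
have [s Bs vs] := decomposes_split i dy.
have e : x i - y i = s - r.
  by apply/eqP; rewrite subr_eq addrAC eq_sym subr_eq addrC -vs vr.
case: dx dy => [_ Wx _] [_ Wy _].
apply: (lspan_disjoint basB.1 (@PB i) (T := B `\` P i)).
- by move=> b [].
- by move=> b [Pb []].
- exact: (subspaceB (lspan_subspace _) (Wx i) (Wy i)).
- by rewrite e; apply: (subspaceB (lspan_subspace _)).
Qed.

(** The vectors that have a decomposition form a subspace containing the
    basis. *)
Lemma decomposes_exists v : exists x, decomposes W v x.
Proof.
have : lspan B v by rewrite basB.2.
move: v; apply: lspan_sub; last first.
  move=> b /[dup] Bb /Pcover[i Pb]; exists (fun j => if j == i then b else 0).
  split.
  - apply: (@sub_finite_set _ _ [set i]); last exact: finite_set1.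
    by move=> j /=; case: ifP => [/eqP//|_]; rewrite eqxx.
  - move=> j; case: ifP => [/eqP->|_]; first exact: sub_lspan.
    exact: lspan0.
  - rewrite -(@fsbig_widen _ _ _ _ [set i])//.
      by rewrite fsbig_set1 eqxx.
    by move=> j [_ /= /eqP/negPf->].
apply/subspaceP; split.
  exists (fun=> 0); split.
  - by apply: (@sub_finite_set _ _ set0) => // i; rewrite /= eqxx.
  - by move=> i; exact: lspan0.
  - by rewrite fsbig1.
move=> a u v [x [fx Wx ->]] [y [fy Wy ->]].
pose D := [set i | x i != 0] `|` [set i | y i != 0].
have fD : finite_set D by rewrite finite_setU.
have out i : (setT `\` D) i -> x i = 0 /\ y i = 0.
  move=> [_ /= /not_orP[]] /negP; rewrite negbK => /eqP-> /negP.
  by rewrite negbK => /eqP->.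
exists (fun i => a *: x i + y i); split.
- apply: sub_finite_set fD => i /=; apply: contraPP => nD.
  by have [//|-> ->] := out i; rewrite scaler0 addr0 eqxx.
- by move=> i; have /subspaceP[_ ML] := lspan_subspace (P i); exact: ML (Wx i) (Wy i).
- rewrite -(@fsbig_widen _ _ _ _ D setT x)//; last by move=> i /out[].
  rewrite -(@fsbig_widen _ _ _ _ D setT y)//; last by move=> i /out[].
  rewrite -(@fsbig_widen _ _ _ _ D setT)//; last first.
    by move=> i /out[/= -> ->]; rewrite scaler0 addr0.
  by rewrite !fsbig_finite// scaler_sumr -big_split.
Qed.

Lemma partition_direct_sum : direct_sum_decomposition W.
Proof.
split=> [i|v]; first exact: lspan_subspace.
have [x dx] := decomposes_exists v; exists x; split=> // y.
exact: decomposes_uniq.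
Qed.

Lemma decomposes_proj v : decomposes W v (fun i => Defs.proj W i v).
Proof.
have [x dx] := decomposes_exists v.
by rewrite /Defs.proj; case: xgetP => [y _ //|/(_ x)].
Qed.

(** This replaces projections by spans of sets of basis vectors, which are easily
    moved along a linear map. *)
Lemma proj_eq0 i v : Defs.proj W i v = 0 <-> lspan (B `\` P i) v.
Proof.
have dv := decomposes_proj v; have [r Br vr] := decomposes_split i dv.
split=> [p0|Bv]; first by rewrite vr p0 add0r.
apply: (lspan_disjoint basB.1 (@PB i) (T := B `\` P i)).
- by move=> b [].
- by move=> b [Pb []].
- by case: dv => _ Wp _; exact: (Wp i).
- rewrite (_ : Defs.proj W i v = v - r); first by apply: (subspaceB (lspan_subspace _)).
  by rewrite {2}vr addrK.
Qed.

End PartitionedBasis.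
End Subspaces.

(** * Quotients of sets *)

Section QuotientSets.
Variables (T : Type) (A : set T) (R : T -> T -> Prop).

(** The axioms are relative to [A] because connection fails to be symmetric at
    the zero vector, which does not belong to a basis. *)
Definition equivalence_on :=
  [/\ forall x, A x -> R x x, forall x y, A x -> A y -> R x y -> R y x
    & forall x y z, A x -> A y -> A z -> R x y -> R y z -> R x z].

Hypothesis eqvR : equivalence_on.
Implicit Types C D : set T.

Lemma equiv_classes_sub C : equiv_classes A R C -> C `<=` A.
Proof. by move=> [a _ <-] x []. Qed.

Lemma equiv_classes_cover x : A x -> exists2 C, equiv_classes A R C & C x.
Proof.
case: eqvR => refl _ _ Ax; exists (Defs.equiv_class A R x); first by exists x.
by split=> //; apply: refl.
Qed.

Lemma equiv_classes_rel C x y :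
  equiv_classes A R C -> C x -> C y <-> A y /\ R x y.
Proof.
case: eqvR => _ sym trans [a Aa <-] [Ax ax]; split=> [[Ay ay]|[Ay xy]].
  by split=> //; apply: (trans x a y) => //; apply: sym.
by split=> //; apply: (trans a x y).
Qed.

Lemma equiv_classes_inter C D x :
  equiv_classes A R C -> equiv_classes A R D -> C x -> D x -> C = D.
Proof.
move=> AC AD Cx Dx; apply/seteqP; split=> y.
  by move=> /(equiv_classes_rel _ AC Cx)/(equiv_classes_rel _ AD Dx).
by move=> /(equiv_classes_rel _ AD Dx)/(equiv_classes_rel _ AC Cx).
Qed.

End QuotientSets.

(** A map that preserves and reflects the relations maps each class onto a
    class.  This is used twice, for basis vectors and for spans of classes. *)
Lemma equiv_classes_image (T U : Type) (A : set T) (R : T -> T -> Prop)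
    (R' : U -> U -> Prop) (h : T -> U) :
  (forall x y, A x -> A y -> R x y <-> R' (h x) (h y)) ->
  equiv_classes (h @` A) R' = image ^~ h @` equiv_classes A R.
Proof.
move=> hR.
have hC x : A x -> Defs.equiv_class (h @` A) R' (h x) = h @` Defs.equiv_class A R x.
  move=> Ax; apply/seteqP; split=> [_ [[y Ay <-] xy]|_ [y [Ay xy] <-]].
    by exists y => //; split=> //; apply/(hR x y).
  by split; [exists y|apply/(hR x y)].
apply/seteqP; split=> [_ [_ [x Ax <-] <-]|_ [_ [x Ax <-] <-]].
  by exists (Defs.equiv_class A R x); rewrite ?hC//; exists x.
by exists (h x); rewrite ?hC//; exists x.
Qed.

Lemma clos_rt_homo (T U : Type) (R : T -> T -> Prop) (R' : U -> U -> Prop)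
    (h : T -> U) : (forall x y, R x y -> R' (h x) (h y)) ->
  forall x y, clos_refl_trans T R x y -> clos_refl_trans U R' (h x) (h y).
Proof.
move=> hR x y; elim=> [a b /hR|a|a b c _ ? _]; first exact: rt_step.
  exact: rt_refl.
exact: rt_trans.
Qed.

(** * Values of multilinear maps at basis vectors *)

Section Construction.
Variables (F : fieldType) (V : lmodType F) (n : nat) (f : ('I_n -> V) -> V).

Lemma entry_lift (T : Type) (v : 'I_n -> T) k : entry k (v k) (v \o lift k) = v.
Proof.
by apply/funext => j; rewrite /entry; case: unliftP => [j' ->|->].
Qed.

(** The span may be replaced by its generators in one entry after the other, as
    the preimage of [M] under a linear map is a subspace. *)
Lemma multilinear_lspan (S : 'I_n -> set V) (M : set V) :
  multilinear f -> is_subspace M ->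
  (forall x, (forall i, S i (x i)) -> M (f x)) ->
  forall v, (forall i, lspan (S i) (v i)) -> M (f v).
Proof.
move=> hf sM Mf v Sv.
(* [m] counts the leading entries in which the span is already allowed *)
suff all_m : forall m w,
    (forall i : 'I_n, (if (i < m)%N then lspan (S i) else S i) (w i)) -> M (f w).
  by apply: (all_m n) => i; rewrite ltn_ord.
elim=> [w Sw|m IHm w Sw]; first exact: Mf.
have [mn|nm] := ltnP m n; last first.
  apply: IHm => i; have := Sw i.
  by rewrite ltnS (leq_trans (ltnW (ltn_ord i)) nm) (leq_trans (ltn_ord i) nm).
pose k := Ordinal mn; rewrite -(entry_lift w k).
suff: lspan (S k) `<=` (fun u => f (entry k u (w \o lift k))) @^-1` M.
  by apply; have := Sw k; rewrite /= ltnSn.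
apply: lspan_sub; first exact: subspace_preimage sM.
move=> u Su; apply: IHm => i; rewrite /entry.
case: unliftP => [i' ei|->]; last by rewrite /= ltnn.
have := Sw i; rewrite ltnS leq_eqVlt.
suff /negPf-> : val i != m by rewrite /= -ei.
by rewrite -[m]/(val k) val_eqE ei eq_sym neq_lift.
Qed.

Lemma fval2_sub (M : set V) k1 W1 k2 W2 : is_subspace M ->
  (forall v : 'I_n -> V, W1 (v k1) -> W2 (v k2) -> M (f v)) ->
  fval2 f k1 W1 k2 W2 `<=` M.
Proof.
by move=> sM Mf; apply: lspan_sub => // _ [v [W1v W2v] <-]; apply: Mf.
Qed.

(** * The connection relation as a transitive closure *)

Section Connection.
Variable B : set V.

(** One application of the operator F to a single vector.  The permutation of
    the arguments is absorbed into [xi], and the two cases of the disjunction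
    are those of tuples in the basis and of tuples in its formal copy. *)
Definition arrow (u w : V) : Prop :=
  w != 0 /\ exists (k : 'I_n) (xi : 'I_n.-1 -> V), (forall r, B (xi r)) /\
    (f (entry k u xi) = w \/ f (entry k w xi) = u).

Local Notation arrows := (clos_refl_trans V arrow).

Lemma Fop_arrow U (X : 'I_n.-1 -> symbol B) w :
  Fop f U X w -> exists2 u, U u & arrow u w.
Proof.
move=> [w0 [xi [[_ [k [s [u Uu uw]]]]|[_ [k [s Uw]]]]]].
  exists u => //; split=> //; exists k, (fun r => set_val (xi (s r))).
  by split; [move=> r; apply: set_valP|left].
eexists; first exact: Uw.
split=> //; exists k, (fun r => set_val (xi (s r))).
by split; [move=> r; apply: set_valP|right].
Qed.

Lemma arrow_Fop u w : arrow u w ->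
  exists X : 'I_n.-1 -> symbol B, forall U : set V, U u -> Fop f U X w.
Proof.
move=> [w0 [k [xi [Bxi uw]]]].
pose xiB r : B := SigSub (mem_set (Bxi r)).
have fE x : fentry f xiB k 1%g x = f (entry k x xi).
  rewrite /fentry; congr (f (entry _ _ _)).
  by apply/funext => r; rewrite perm1.
case: uw => uw; [exists (fun r => inl (xiB r))|exists (fun r => inr (xiB r))].
  move=> U Uu; split=> //; exists xiB; left; split=> //.
  by exists k, 1%g, u; rewrite // fE.
move=> U Uu; split=> //; exists xiB; right; split=> //.
by exists k, 1%g; rewrite fE uw.
Qed.

Lemma foldl_Fop_arrows (Xs : seq ('I_n.-1 -> symbol B)) U w :
  foldl (@Fop F V n f B) U Xs w -> exists2 u, U u & arrows u w.
Proof.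
elim: Xs U => [|X Xs IH] U /=; first by exists w => //; apply: rt_refl.
move=> /IH[u' /Fop_arrow[u Uu uu'] u'w]; exists u => //.
by apply: rt_trans u'w; apply: rt_step.
Qed.

(** F(U, X) is the union of the F({u}, X) for u in U, so that an element
    reached through a list of tuples is reached through a path of vectors.
    Conversely the sets along the list are nonempty because the last one is. *)
Lemma connectedE e e' : connected f B e e' <-> arrows e e'.
Proof.
split=> [[->|[Xs [_ _ /foldl_Fop_arrows[u ->]]]]//|]; first exact: rt_refl.
move=> /clos_rt_rtn1_iff; elim=> [|y z yz _ IH]; first by left.
right; have [X FX] := arrow_Fop yz.
have [Xs Xsz] : exists Xs, foldl (@Fop F V n f B) [set e] (rcons Xs X) z.
  case: IH => [ey|[Xs [_ _ Xsy]]].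
    by exists [::]; apply: FX.
  by exists Xs; rewrite foldl_rcons; apply: FX.
exists (rcons Xs X); split=> //; first by rewrite size_rcons.
move=> m _; move: Xsz; rewrite -{1}(cat_take_drop m (rcons Xs X)) foldl_cat.
by move=> /foldl_Fop_arrows[u ? _]; exists u.
Qed.

(** Exchanging the roles of a tuple and of its formal copy reverses an arrow,
    except that arrows only end at nonzero vectors. *)
Lemma arrow_sym u w : u != 0 -> arrow u w -> arrow w u.
Proof.
move=> u0 [_ [k [xi [Bxi uw]]]]; split=> //; exists k, xi; split=> //.
by case: uw; [right|left].
Qed.

Lemma arrows_sym u w : u != 0 -> arrows u w -> arrows w u.
Proof.
move=> u0 uw; suff: w != 0 /\ arrows w u by case.
elim: uw u0 => {u w} [u w uw|u|u v w _ IH1 _ IH2] u0.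
- by split; [case: uw|apply/rt_step/arrow_sym].
- by split=> //; apply: rt_refl.
- have [v0 vu] := IH1 u0; have [w0 wv] := IH2 v0.
  by split=> //; apply: rt_trans wv vu.
Qed.

(** The value itself, usually not a basis vector, is the intermediate point of the
    path between two of its arguments. *)
Lemma connected_value x i j :
  (forall i, B (x i)) -> x i != 0 -> x j != 0 -> f x != 0 ->
  connected f B (x i) (x j).
Proof.
move=> Bx xi0 xj0 fx0; apply/connectedE.
have to_fx k : arrow (x k) (f x).
  split=> //; exists k, (x \o lift k); split; first by move=> r; apply: Bx.
  by left; rewrite entry_lift.
by apply: (rt_trans _ _ _ (f x)); apply: rt_step => //; apply: arrow_sym.
Qed.

End Connection.

(** * The decomposition obtained from a basis *)

Section Decomposition.
Variables (B : set V) (basB : is_basis B).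

Local Notation Q := (B_quot f B).

Lemma connected_equivalence : equivalence_on B (connected f B).
Proof.
split=> [x _|x y Bx _|x y z _ _ _]; first by left.
  move=> /connectedE xy; apply/connectedE/arrows_sym => //.
  exact: lin_indep_neq0 basB.1 _ Bx.
by move=> /connectedE xy /connectedE yz; apply/connectedE; apply: rt_trans yz.
Qed.

Lemma quot_sub (C : Q) : set_val C `<=` B.
Proof. exact: (equiv_classes_sub (set_valP C)). Qed.

Lemma quot_cover b : B b -> exists C : Q, set_val C b.
Proof.
move=> /(equiv_classes_cover connected_equivalence)[C QC Cb].
by exists (SigSub (mem_set QC)).
Qed.

Lemma quot_disj (C D : Q) b : set_val C b -> set_val D b -> C = D.
Proof.
move=> Cb Db; apply: val_inj.
exact (equiv_classes_inter connected_equivalence (set_valP C) (set_valP D) Cb Db).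
Qed.

Lemma Vclass_basis (C : Q) : B `&` Vclass C = set_val C.
Proof. exact: (lspan_inter basB.1 (@quot_sub C)). Qed.

Lemma basisD_Vclass (C : Q) : B `\` Vclass C = B `\` set_val C.
Proof. by rewrite -[in RHS]Vclass_basis setDIr setDv set0U. Qed.

Lemma Vclass_inj : injective (@Vclass F V n f B).
Proof. by move=> C D CD; apply: val_inj; rewrite -!set_valE -!Vclass_basis CD. Qed.

Lemma proj_Vclass_eq0 (C : Q) v :
  Defs.proj (@Vclass F V n f B) C v = 0 <-> lspan (B `\` Vclass C) v.
Proof.
rewrite basisD_Vclass.
exact: (proj_eq0 basB quot_sub quot_cover quot_disj).
Qed.

(** When [W] is the span of a connection class, [lspan (B `\` W)] is the kernel of
    the projection on [W]; so this is the nonvanishing of one of the terms of the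
    sum that links two classes ([link_space_neq0]). *)
Definition sees (W W' : set V) : Prop :=
  exists k1 k2 : 'I_n, (k1 < k2)%N /\
    exists v : 'I_n -> V, [/\ W' (v k1), W' (v k2) & ~ lspan (B `\` W) (f v)].

Definition linked (W W' : set V) : Prop :=
  [/\ Vfamily f B W, Vfamily f B W' & sees W W' \/ sees W' W].

Lemma link_space_neq0 (C D : Q) : link_space C D <> [set 0] <->
  sees (Vclass C) (Vclass D) \/ sees (Vclass D) (Vclass C).
Proof.
have proj0 (C' D' : Q) (k1 k2 : 'I_n) u : (k1 < k2)%N -> ~ sees (Vclass C') (Vclass D') ->
    fval2 f k1 (Vclass D') k2 (Vclass D') u ->
    Defs.proj (@Vclass F V n f B) C' u = 0.
  move=> k12 nsee fu; apply/proj_Vclass_eq0; move: u fu.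
  apply: fval2_sub => [|v v1 v2]; first exact: lspan_subspace.
  by apply: contrapT => nv; apply: nsee; exists k1, k2; split=> //; exists v.
have fval2_in (k1 k2 : 'I_n) (D' : Q) v : Vclass D' (v k1) -> Vclass D' (v k2) ->
    fval2 f k1 (@Vclass F V n f B D') k2 (Vclass D') (f v).
  by move=> v1 v2; apply: sub_lspan; exists v.
split=> [nz|sees_CD L0].
  apply: contrapT => /not_orP[nCD nDC]; apply: nz; apply: lspan_eq0.
  move=> _ [_ [k1 [k2 [k12 [->|->]]]] [u fu <-]] /=; exact: proj0 fu.
have in_link u (E : set V) : (exists k1 k2 : 'I_n, (k1 < k2)%N /\
       (E = Defs.proj (@Vclass F V n f B) C @` fval2 f k1 (Vclass D) k2 (Vclass D) \/
        E = Defs.proj (@Vclass F V n f B) D @` fval2 f k1 (Vclass C) k2 (Vclass C)))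
    -> E u -> u = 0.
  move=> hE Eu; have : link_space C D u by apply: sub_lspan; exists E.
  by rewrite L0.
case: sees_CD => -[k1 [k2 [k12 [v [v1 v2]]]]]; apply; apply/proj_Vclass_eq0.
  apply: (in_link _ (Defs.proj (@Vclass F V n f B) C @`
      fval2 f k1 (Vclass D) k2 (Vclass D))).
    by exists k1, k2; split=> //; left.
  by exists (f v) => //; apply: fval2_in.
apply: (in_link _ (Defs.proj (@Vclass F V n f B) D @`
      fval2 f k1 (Vclass C) k2 (Vclass C))).
  by exists k1, k2; split=> //; right.
by exists (f v) => //; apply: fval2_in.
Qed.

(** Chains of classes compose because a class is determined by its span
    ([Vclass_inj]). *)
Lemma approxE W W' : approx f B W W' <-> clos_refl_trans _ linked W W'.
Proof.
split=> [[->|[m [xi [<- <-]]]]|]; first exact: rt_refl.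
  elim: m => [|m IHm] link_xi; first exact: rt_refl.
  apply: (rt_trans _ _ _ (Vclass (xi m))).
    by apply: IHm => r rm; apply/link_xi/ltnW.
  apply: rt_step; split; try by exists (xi m).
    by exists (xi m.+1).
  exact/link_space_neq0/link_xi.
move=> /clos_rt_rtn1_iff; elim=> [|_ _ [[C _ <-] [D _ <-] CD] _ IH]; first by left.
right; move/link_space_neq0: CD => CD.
have [m [xi [xi0 xim link_xi]]] : exists (m : nat) (xi : nat -> Q),
    [/\ Vclass (xi 0%N) = W, Vclass (xi m) = Vclass C
      & forall r, (r < m)%N -> link_space (xi r) (xi r.+1) <> [set 0]].
  by case: IH => [->|//]; exists 0%N, (fun=> C).
(* the chain [xi] is prolonged by the class [D] *)
exists m.+1, (fun r => if (r <= m)%N then xi r else D).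
split=> //=; first by rewrite ltnn.
move=> r; rewrite ltnS => rm; rewrite rm.
case: ltnP => [/link_xi//|mr]; have -> : r = m by apply/eqP; rewrite eqn_leq rm.
by rewrite (Vclass_inj xim).
Qed.

Lemma linked_sym W W' : linked W W' -> linked W' W.
Proof. by move=> [? ? [?|?]]; split=> //; [right|left]. Qed.

Lemma approx_equivalence : equivalence_on (Vfamily f B) (approx f B).
Proof.
split=> [x _|x y _ _|x y z _ _ _]; first by left.
  move=> /approxE xy; apply/approxE.
  elim: xy => {x y} [x y /linked_sym|x|x y z _ yx _ zy]; first exact: rt_step.
    exact: rt_refl.
  exact: rt_trans zy yx.
by move=> /approxE xy /approxE yz; apply/approxE; apply: rt_trans yz.
Qed.

Lemma Vfamily_inter W W' b :
  Vfamily f B W -> Vfamily f B W' -> B b -> W b -> W' b -> W = W'.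
Proof.
move=> [C _ <-] [D _ <-] Bb Cb Db; congr Vclass.
by apply: (@quot_disj _ _ b); rewrite -Vclass_basis.
Qed.

Local Notation QQ := (Vfamily_quot f B).

(** The part of the basis that spans the summand [Gamma c], see
    [Gamma_block]. *)
Definition block (c : QQ) : set V := B `&` \bigcup_(W in set_val c) W.

Lemma in_Vfamily (c : QQ) W : set_val c W -> Vfamily f B W.
Proof. exact: (equiv_classes_sub (set_valP c)). Qed.

Lemma Gamma_block (c : QQ) : Gamma c = lspan (block c).
Proof.
apply/seteqP; split; last by apply: lspanS => b [].
apply: lspan_sub; first exact: lspan_subspace.
move=> v [W cW]; have [C _ WC] := in_Vfamily cW.
rewrite -WC; move: v; apply: lspanS => b Cb; split; first exact: quot_sub Cb.
by exists W => //; rewrite -WC; apply: sub_lspan.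
Qed.

Lemma block_sub (c : QQ) : block c `<=` B. Proof. by move=> b []. Qed.

Lemma block_cover b : B b -> exists c : QQ, block c b.
Proof.
move=> Bb; have [C Cb] := quot_cover Bb.
have FC : Vfamily f B (Vclass C) by exists C.
have [c Qc cC] := equiv_classes_cover approx_equivalence FC.
exists (SigSub (mem_set Qc)); split=> //.
by exists (Vclass C) => //; apply: sub_lspan.
Qed.

Lemma block_disj (c d : QQ) b : block c b -> block d b -> c = d.
Proof.
move=> [Bb [W cW Wb]] [_ [W' dW' Wb']]; apply: val_inj.
apply: (equiv_classes_inter approx_equivalence (set_valP c) (set_valP d) cW).
by rewrite (Vfamily_inter (in_Vfamily cW) (in_Vfamily dW') Bb).
Qed.

Lemma same_Vfamily W x i j : Vfamily f B W -> (forall i, B (x i)) ->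
  f x != 0 -> W (x i) -> W (x j).
Proof.
move=> [C _ <-] Bx fx0 Cxi.
have {}Cxi : set_val C (x i) by rewrite -Vclass_basis.
apply: sub_lspan.
apply/(equiv_classes_rel connected_equivalence _ (set_valP C) Cxi); split=> //.
by apply: connected_value => //; apply: lin_indep_neq0 basB.1 _ _.
Qed.

Lemma same_block (c : QQ) x i j : (forall i, B (x i)) -> f x != 0 ->
  block c (x i) -> block c (x j).
Proof.
move=> Bx fx0 [_ [W cW Wx]]; split=> //; exists W => //.
exact: same_Vfamily (in_Vfamily cW) Bx fx0 Wx.
Qed.

Hypotheses (hn : (2 <= n)%N) (hf : multilinear f).

Lemma decomposes_sub (I : choiceType) (W : I -> set V) (M : set V) v x :
  is_subspace M -> decomposes W v x -> (forall i, M (x i)) -> M v.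
Proof.
move=> sM [fx _ ->] Mx.
rewrite -(@fsbig_widen _ _ _ _ [set i | x i != 0])//; last first.
  by move=> i [_ /= /negP]; rewrite negbK => /eqP.
by rewrite fsbig_finite//; apply: subspace_sum.
Qed.

(** All the arguments lie in the span [W] of a single class.  A class along
    which the value has a nonzero component therefore sees [W], the two
    entries required by [sees] being the first two: this is where arity at
    least 2 matters.  So every component of the value lies in a class
    that belongs to [c]. *)
Lemma Gamma_value (c : QQ) x i : (forall i, B (x i)) -> block c (x i) ->
  Gamma c (f x).
Proof.
move=> Bx ci; have sG : is_subspace (Gamma c) by exact: lspan_subspace.
have [->|fx0] := eqVneq (f x) 0; first exact: subspace0.
have [_ [W cW Wxi]] := ci; have FW := in_Vfamily cW.
have Wx j : W (x j) by exact: (same_Vfamily j FW Bx fx0 Wxi).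
apply: (decomposes_sub sG (decomposes_proj basB quot_cover (f x))).
move=> C; set y := Defs.proj _ _ _.
have [->|/eqP y0] := eqVneq y 0; first exact: subspace0.
suff cC : set_val c (Vclass C).
  apply: sub_lspan; exists (Vclass C) => //.
  by have [_ Wp _] := decomposes_proj basB quot_cover (f x); exact: (Wp C).
apply/(equiv_classes_rel approx_equivalence _ (set_valP c) cW).
have FC : Vfamily f B (Vclass C) by exists C.
split=> //; apply/approxE/rt_step; split=> //; right.
exists (Ordinal (ltnW hn)), (Ordinal hn); split=> //; exists x; split=> //.
by move/proj_Vclass_eq0.
Qed.

Lemma Gamma_f_decomposition : f_decomposition f (@Gamma F V n f B).
Proof.
have GE : @Gamma F V n f B = fun c => lspan (block c).
  by apply/funext => c; apply: Gamma_block.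
split.
- by rewrite GE; apply: (partition_direct_sum basB block_sub block_cover block_disj).
- move=> c d cd i j ij; apply: lspan_eq0 => _ [v [ci dj] <-].
  pose S k := if k == i then block c else if k == j then block d else B.
  apply: (@multilinear_lspan S [set 0] hf (subspace_set0 V)) => [x Sx|k]; last first.
    rewrite /S; case: eqP => [->|_]; first by rewrite -Gamma_block.
    by case: eqP => [->|_]; rewrite -?Gamma_block// basB.2.
  have Bx k : B (x k).
    by have := Sx k; rewrite /S; case: ifP => _; [|case: ifP => _ //]; apply: block_sub.
  apply/eqP; apply: contraT => fx0; case/eqP: cd.
  have ci' : block c (x i) by have := Sx i; rewrite /S eqxx.
  apply: (block_disj (same_block j Bx fx0 ci')).
  by have := Sx j; rewrite /S eq_sym (negPf ij) eqxx.
- move=> c i; apply: lspan_sub; first exact: lspan_subspace.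
  move=> _ [v ci <-].
  pose S k := if k == i then block c else B.
  have sG : is_subspace (Gamma c) by exact: lspan_subspace.
  apply: (@multilinear_lspan S _ hf sG) => [x Sx|k]; last first.
    by rewrite /S; case: eqP => [->|_]; rewrite -?Gamma_block// basB.2.
  apply: (@Gamma_value c x i); last by have := Sx i; rewrite /S eqxx.
  by move=> k; have := Sx k; rewrite /S; case: ifP => // _; apply: block_sub.
Qed.

End Decomposition.
End Construction.

(** * Naturality of the construction *)

Section Transport.
Variables (F : fieldType) (V : lmodType F) (n : nat) (f : ('I_n -> V) -> V).

(** The inverse is part of the data, so that a statement proved for [g] can be
    applied to [h] by [inverse_automorphisms_sym]. *)
Definition inverse_automorphisms (g h : V -> V) : Prop :=
  [/\ linear g, cancel g h, cancel h g & forall v, f (g \o v) = g (f v)].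

Lemma inverse_automorphisms_sym g h :
  inverse_automorphisms g h -> inverse_automorphisms h g.
Proof.
move=> [lg gK hK fg]; split=> // [a u v|v].
  by rewrite -{1}[u]hK -{1}[v]hK -lg gK.
rewrite -[LHS]gK -fg; congr (h (f _)).
by apply/funext => i /=; rewrite hK.
Qed.

Lemma image_inverse (T U : Type) (g : T -> U) h (S : set T) :
  cancel g h -> h @` (g @` S) = S.
Proof. by move=> gK; rewrite image_comp eq_image_id//= => x _; apply: gK. Qed.

Lemma linear_inj_neq0 (g : V -> V) w : linear g -> injective g -> w != 0 -> g w != 0.
Proof.
move=> lg ig; apply: contra_neq => gw0; apply: ig; rewrite gw0.
have := lg (-1) w w; rewrite !scaleN1r addNr gw0 => ->.
by rewrite addr0 oppr0.
Qed.

Lemma arrow_automorphism B g h u w : inverse_automorphisms g h ->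
  arrow f B u w -> arrow f (g @` B) (g u) (g w).
Proof.
move=> [lg gK hK fg] [w0 [k [xi [Bxi uw]]]].
split; first exact: linear_inj_neq0 (can_inj gK) w0.
exists k, (g \o xi); split; first by move=> r; exists (xi r).
have gE x : entry k (g x) (g \o xi) = g \o entry k x xi.
  by apply/funext => i; rewrite /= /entry; case: unlift.
by rewrite !gE !fg; case: uw => <-; [left|right].
Qed.

(** The backward implication is the forward one for the inverse automorphism,
    since [h @` (g @` B) = B]. *)
Lemma connected_automorphism B g h x y : inverse_automorphisms g h ->
  connected f B x y <-> connected f (g @` B) (g x) (g y).
Proof.
have homo B' g' h' x' y' : inverse_automorphisms g' h' ->
    connected f B' x' y' -> connected f (g' @` B') (g' x') (g' y').
  move=> gh' /connectedE xy; apply/connectedE; move: xy.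
  by apply: clos_rt_homo => u w; apply: arrow_automorphism gh'.
move=> gh; split; first exact: homo gh.
move/(homo _ _ _ _ _ (inverse_automorphisms_sym gh)).
by have [_ gK _ _] := gh; rewrite image_inverse// !gK.
Qed.

Lemma B_quot_automorphism B g h : inverse_automorphisms g h ->
  B_quot f (g @` B) = image ^~ g @` B_quot f B.
Proof.
by move=> gh; apply: equiv_classes_image => x y _ _; apply: connected_automorphism gh.
Qed.

Lemma VfamilyE B : Vfamily f B = @lspan F V @` B_quot f B.
Proof.
apply/seteqP; split=> [_ [C _ <-]|_ [C QC <-]].
  by exists (set_val C) => //; apply: set_valP.
by exists (SigSub (mem_set QC)).
Qed.

Lemma Vfamily_automorphism B g h : inverse_automorphisms g h ->
  Vfamily f (g @` B) = image ^~ g @` Vfamily f B.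
Proof.
move=> gh; have [lg _ _ _] := gh.
rewrite !VfamilyE (B_quot_automorphism _ gh) !image_comp.
by apply: eq_imagel => C _ /=; rewrite lspan_image.
Qed.

Lemma sees_automorphism B g h W W' : inverse_automorphisms g h ->
  sees f B W W' -> sees f (g @` B) (g @` W) (g @` W').
Proof.
move=> [lg gK hK fg] [k1 [k2 [k12 [v [v1 v2 nv]]]]].
exists k1, k2; split=> //; exists (g \o v); split.
- by exists (v k1).
- by exists (v k2).
have -> : (g @` B) `\` (g @` W) = g @` (B `\` W).
  apply/seteqP; split=> [_ [[b Bb <-] nW]|_ [b [Bb nW] <-]].
    by exists b => //; split=> // Wb; apply: nW; exists b.
  by split; [exists b|move=> [c Wc /(can_inj gK) cb]; apply: nW; rewrite -cb].
rewrite fg -lspan_image// => -[u Bu /(can_inj gK) uv].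
by apply: nv; rewrite -uv.
Qed.

Lemma linked_automorphism B g h W W' : inverse_automorphisms g h ->
  linked f B W W' -> linked f (g @` B) (g @` W) (g @` W').
Proof.
move=> gh [FW FW' WW']; split; rewrite ?(Vfamily_automorphism _ gh).
- by exists W.
- by exists W'.
- by case: WW' => /(sees_automorphism gh); [left|right].
Qed.

Lemma basis_automorphism B g h : inverse_automorphisms g h ->
  is_basis B -> is_basis (g @` B).
Proof.
move=> [lg gK hK _] [indB spanB]; split; last first.
  rewrite -lspan_image// spanB; apply/seteqP; split=> // v _.
  by exists (h v).
move=> s c us sB s0 b bs; have [e Be eb] := sB b bs.
have g0 : g 0 = 0.
  by have := lg (-1) 0 0; rewrite !scaleN1r addNr => ->; rewrite addNr.
have gD : {morph g : x y / x + y}.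
  by move=> x y; rewrite -[x]scale1r lg !scale1r.
have gZ a : {morph g : x / a *: x}.
  by move=> x; rewrite -[a *: x]addr0 lg g0 addr0.
suff /(_ e) : forall e, e \in map h s -> c (g e) = 0.
  by rewrite eb; apply; apply/mapP; exists b; rewrite // -eb gK.
apply: indB => [|e' /mapP[b' /sB[e'' Be'' <-] ->]|].
- by rewrite map_inj_uniq//; apply: can_inj hK.
- by rewrite gK.
apply: (can_inj gK); rewrite big_map g0 (big_morph g gD g0) -[RHS]s0.
by apply: eq_bigr => b' _; rewrite gZ hK.
Qed.

Lemma approx_automorphism B g h W W' : is_basis B -> inverse_automorphisms g h ->
  approx f B W W' <-> approx f (g @` B) (g @` W) (g @` W').
Proof.
have homo B' g' h' X X' : is_basis B' -> inverse_automorphisms g' h' ->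
    approx f B' X X' -> approx f (g' @` B') (g' @` X) (g' @` X').
  move=> basB gh' /(approxE f basB) approxX.
  apply/(approxE f (basis_automorphism gh' basB)); move: approxX.
  by apply: (@clos_rt_homo _ _ _ _ (image ^~ g')) => Y Y'; apply: linked_automorphism gh'.
move=> basB gh; split; first exact: homo gh.
move/(homo _ _ _ _ _ (basis_automorphism gh basB) (inverse_automorphisms_sym gh)).
by have [_ gK _ _] := gh; rewrite !image_inverse.
Qed.

Lemma Vfamily_quot_automorphism B g h : is_basis B -> inverse_automorphisms g h ->
  Vfamily_quot f (g @` B) = image ^~ (image ^~ g) @` Vfamily_quot f B.
Proof.
move=> basB gh; rewrite /Vfamily_quot (Vfamily_automorphism _ gh).
by apply: equiv_classes_image => W W' _ _; apply: approx_automorphism basB gh.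
Qed.

Lemma sum_subspaces_image (g : V -> V) (S : set (set V)) : linear g ->
  sum_subspaces (image ^~ g @` S) = g @` sum_subspaces S.
Proof.
move=> lg; rewrite /sum_subspaces lspan_image//; congr lspan.
by rewrite bigcup_image image_bigcup.
Qed.

(** The defect [f (g \o v) - g (f v)] is multilinear in [v] and vanishes on the
    basis. *)
Lemma automorphism_of_basis B (g : {linear V -> V}) : multilinear f -> is_basis B ->
  (forall xi : 'I_n -> V, (forall i, B (xi i)) -> f (g \o xi) = g (f xi)) ->
  forall v, f (g \o v) = g (f v).
Proof.
move=> hf [_ spanB] fg v; apply/eqP; rewrite -subr_eq0; apply/eqP.
pose d w := f (g \o w) - g (f w).
have md : multilinear d.
  move=> k x a u w; rewrite /d hf linearP scalerBr.
  have gE y : g \o entry k y x = entry k (g y) (g \o x).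
    by apply/funext => i; rewrite /= /entry; case: unlift.
  by rewrite !gE linearP hf addrACA opprD.
apply: (@multilinear_lspan _ _ _ d (fun=> B) [set 0] md (subspace_set0 V)).
  by move=> x Bx; rewrite /d /= fg// subrr.
by move=> i; rewrite spanB.
Qed.

End Transport.

(** Quotients appear as types attached to sets, so an equality between a set and
    an injective image of another becomes a bijection between types. *)
Lemma image_set_type_bijection (T U : Type) (A : set T) (A' : set U) (H : T -> U) :
  injective H -> A' = H @` A ->
  exists2 sigma : A -> A', bijective sigma & forall a, set_val (sigma a) = H (set_val a).
Proof.
move=> injH ->.
have HA (a : A) : (H @` A) (H (set_val a)) by exists (set_val a) => //; apply: set_valP.
pose sigma (a : A) : H @` A := SigSub (mem_set (HA a)).
have /choice[tau tauE] : forall b : H @` A, exists a : A, H (set_val a) = set_val b.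
  by move=> b; have [a Aa ab] := set_valP b; exists (SigSub (mem_set Aa)).
exists sigma => //; exists tau => [a|b].
  by apply: val_inj; apply: injH; apply: tauE (sigma a).
by apply: val_inj; apply: tauE.
Qed.

(** * Isomorphism of the two decompositions *)

Theorem proposition3p3 (F : fieldType) (V : lmodType F) (n : nat)
    (hn : (2 <= n)%N) (f : ('I_n -> V) -> V) (hf : multilinear f)
    (B : set V) (hB : is_basis B)
    (g : {linear V -> V}) (hg : bijective g)
    (hfg : forall xi : 'I_n -> V, (forall i, B (xi i)) ->
       f (g \o xi) = g (f xi)) :
  isomorphic_decompositions f (@Gamma F V n f B) (@Gamma F V n f (g @` B)).
Proof.
have fg := automorphism_of_basis hf hB hfg.
have [h gK hK] := hg.
have gh : inverse_automorphisms f g h by split=> // a u v; apply: linearP.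
split.
- exact: Gamma_f_decomposition.
- exact: Gamma_f_decomposition (basis_automorphism gh hB) hn hf.
have inj_image : injective (image ^~ (image ^~ g) : set (set V) -> set (set V)).
  apply: can_inj (image ^~ (image ^~ h)) _ => S; apply: image_inverse => W.
  exact: image_inverse.
have [sigma sigma_bij sigmaE] :=
  image_set_type_bijection inj_image (Vfamily_quot_automorphism hB gh).
exists g, sigma; split=> // c.
rewrite /Gamma sigmaE sum_subspaces_image// => a u v; exact: linearP.
Qed.
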